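(* Let $\Omega=(a,b)\subset\mathbb{R}$ be a bounded open interval, $f\in BV(\Omega)$ and $\alpha\in C(\overline{\Omega})$ with $\alpha>0$ on $\overline\Omega$. Let $u\in BV(\Omega)$ be the solution of $$\min_{u\in BV(\Omega)}\ \frac12\int_\Omega (f-u)^2\,dx+\int_\Omega \alpha(x)\,d|Du| .$$ Let $x\in\Omega$ be such that $\alpha$ is differentiable at $x$ and $|Df|(\{x\})=0$, i.e. $x\notin J_f$. Then $x\notin J_u$.
   Context: For $u\in BV(\Omega)$, $Du$ denotes its distributional derivative (a finite Radon measure), $|Du|$ the total variation measure of $Du$, and $J_u=\{x\in\Omega:\ |Du|(\{x\})\neq 0\}$ the set of atoms of $Du$ (jump set of $u$). The minimisation problem has a unique solution. *)

(* Defs.v *)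
From HB Require Import structures.
From mathcomp Require Import all_boot all_order all_algebra.
From mathcomp Require Import all_classical all_reals all_analysis.

Set Implicit Arguments.
Unset Strict Implicit.
Unset Printing Implicit Defensive.

Import Order.TTheory GRing.Theory Num.Theory.
Import numFieldNormedType.Exports.

Local Open Scope classical_set_scope.
Local Open Scope ring_scope.

Section charges.
Context d (T : measurableType d) (R : realType).
Variable nu : {charge set T -> \bar R}.

(* A chosen Hahn decomposition; by Hahn_decomposition_uniq nothing below
   depends on the choice. *)
Definition hahn_pos : set T := projT1 (cid (Hahn_decomposition nu)).

Definition hahn_neg : set T :=
  projT1 (cid (projT2 (cid (Hahn_decomposition nu)))).

Definition hahnP : hahn_decomposition nu hahn_pos hahn_neg :=
  projT2 (cid (projT2 (cid (Hahn_decomposition nu)))).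

Definition charge_total_variation : {measure set T -> \bar R} :=
  charge_variation hahnP.

Definition charge_Rintegral (D : set T) (g : T -> R) : R :=
  \int[jordan_pos hahnP]_(x in D) g x - \int[jordan_neg hahnP]_(x in D) g x.

End charges.

Section bounded_variation.
Context {R : realType}.

(* Elements of C_c^oo(Omega), extended by 0 to the whole line. *)
Definition test_function (Omega : set R) (phi : R -> R) : Prop :=
  (forall (n : nat) (x : R), derivable (derive1n n phi) x 1) /\
  exists K : set R,
    [/\ compact K, K `<=` Omega & forall x, ~ K x -> phi x = 0].

(* An element of BV(]a, b[) is given by a representative, defined on the whole
   line (only its values on ]a, b[ matter), together with its distributional
   derivative. The latter is a finite signed Borel measure on ]a, b[, encoded
   as a charge on the line that is concentrated on ]a, b[; the last two fields
   determine it uniquely from the representative. *)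
Record BV (a b : R) := mkBV {
  BV_fun :> R -> R ;
  BV_deriv : {charge set (measurableTypeR R) -> \bar R} ;
  BV_integrable :
    lebesgue_measure.-integrable `]a, b[ (EFin \o BV_fun) ;
  BV_deriv_concentrated : forall A : set (measurableTypeR R),
    measurable A -> BV_deriv A = BV_deriv (A `&` `]a, b[) ;
  BV_derivP : forall phi : R -> R, test_function `]a, b[ phi ->
    \int[lebesgue_measure]_(x in `]a, b[) (BV_fun x * derive1 phi x) =
    - charge_Rintegral BV_deriv `]a, b[ phi }.

Definition jump_set (a b : R) (u : BV a b) : set R :=
  [set x | (x \in `]a, b[) /\
    charge_total_variation (BV_deriv u) [set x] <> 0%E].

(* The objective, with values in [0, +oo] so that both integrals of nonnegative
   functions make sense without integrability conditions. *)
Definition weighted_TV_energy (a b : R) (f : R -> R) (alpha : R -> R)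
    (u : BV a b) : \bar R :=
  ((2^-1)%:E * \int[lebesgue_measure]_(x in `]a, b[) ((f x - u x) ^+ 2)%:E +
   \int[charge_total_variation (BV_deriv u)]_(x in `]a, b[) (alpha x)%:E)%E.

Definition is_minimizer (a b : R) (f : R -> R) (alpha : R -> R)
    (u : BV a b) : Prop :=
  forall v : BV a b,
    (weighted_TV_energy f alpha u <= weighted_TV_energy f alpha v)%E.

End bounded_variation.

(* Main.v *)
(**
  Suppose Du has an atom of mass m <> 0 at x, and put t = m / 4. For small r > 0
  perturb u by t k, where k is 1 on ]x - r, x[ and -1 on ]x, x + r[: this moves
  the part 2 t of the atom, half to x - r and half to x + r, so that the
  weighted total variation grows by at most
  |t| (alpha (x - r) + alpha (x + r) - 2 alpha x), which is o(r) because alpha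
  is differentiable at x. The fidelity term changes by
  - t int (f - u) k + t^2 r. As k is the derivative of the tent of height r at
  x, int g k = - r Dg({x}) + o(r) for every g in BV; hence int (f - u) k =
  m r + o(r), f having no atom at x. Minimality of u, divided by r, gives
  0 <= - t m + t^2 < 0 as r tends to 0.
*)

Require Import Defs.
From HB Require Import structures.
From mathcomp Require Import all_boot all_order all_algebra.
From mathcomp Require Import all_classical all_reals all_analysis.
From mathcomp Require Import measurable_realfun ring lra.

Set Implicit Arguments.
Unset Strict Implicit.
Unset Printing Implicit Defensive.

Import Order.TTheory GRing.Theory Num.Theory.
Import numFieldNormedType.Exports.

Local Open Scope classical_set_scope.
Local Open Scope ring_scope.

(** * Smooth functions *)

(** The derivative of a [BV] function is tested only against smooth functions of compact support,
    whereas the tent is merely Lipschitz. Smooth plateaus built from exp(-1/t) therefore approach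
    the indicator of ]x - r, x[ from below, their primitives give smooth tents, and both sides of
    the integration by parts pass to the limit by dominated convergence. The second obstacle is that
    the Hahn decomposition of Du changes under the perturbation. Integrals against the new
    derivative are computed from any representation of it as a difference of finite measures, while
    its variation is only bounded from above. Atoms of Du at x - r or x + r do no harm: mass added
    there costs at most |t| each, whatever Du does. What matters is the side of the new
    decomposition on which x falls, and this is fixed by the sign of the mass m - 2t that remains
    there. *)

Section smooth.
Context {R : realType}.
Implicit Types (f g : R -> R) (n k : nat).

(** The recursion differentiates first, so that an induction with [f] generalised passes from a sum,
    a product or an affine substitution to its derivative. Index [n] stands for n + 1
    derivatives. *)
Fixpoint nderivable n f : Prop :=
  (forall x, derivable f x 1) /\ if n is m.+1 then nderivable m (derive1 f) else True.

Definition smooth f := forall n, nderivable n f.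

Lemma nderivable_derivable n f : nderivable n f -> forall x, derivable f x 1.
Proof. by case: n => [|n] []. Qed.

Lemma nderivableW n f : nderivable n.+1 f -> nderivable n f.
Proof.
elim: n f => [|n IHn] f; first by case.
by case=> df /IHn df'; split.
Qed.

Lemma derivable_derive1n n m f :
  nderivable (n + m) f -> nderivable m (derive1n n f).
Proof.
by elim: n f => [//|n IHn] f [_ /IHn]; rewrite /derive1n iterSr.
Qed.

Lemma smooth_derivable_derive1n f : smooth f ->
  forall n x, derivable (derive1n n f) x 1.
Proof.
move=> sf n; apply: (@nderivable_derivable 0).
by apply: derivable_derive1n; exact: sf.
Qed.

Lemma nderivable_is_derive n f f' : (forall x : R, is_derive x 1 f (f' x)) ->
  nderivable n f' -> nderivable n.+1 f.
Proof.
move=> dff' nf'; split=> [x|]; first exact: (@ex_derive _ _ _ _ _ _ _ (dff' x)).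
suff -> : derive1 f = f' by [].
by apply/funext => x; rewrite derive1E (@derive_val _ _ _ _ _ _ _ (dff' x)).
Qed.

Lemma is_derive_derive1 f (x : R) : derivable f x 1 -> is_derive x 1 f (derive1 f x).
Proof. by move=> /derivableP; rewrite derive1E. Qed.

Lemma nderivableD n f g :
  nderivable n f -> nderivable n g -> nderivable n (f \+ g).
Proof.
elim: n f g => [|n IHn] f g.
  by move=> [df _] [dg _]; split=> // x; apply: derivableD.
move=> [df nf] [dg ng]; apply: nderivable_is_derive (IHn _ _ nf ng) => x.
by apply: is_deriveD; exact: is_derive_derive1.
Qed.

Lemma nderivableZ n c f : nderivable n f -> nderivable n (fun x => c * f x).
Proof.
elim: n f => [|n IHn] f; first by move=> [df _]; split=> // x; apply: derivableZ.
move=> [df nf]; apply: nderivable_is_derive (IHn _ nf) => x.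
by apply: is_deriveZ; exact: is_derive_derive1.
Qed.

Lemma nderivableM n f g :
  nderivable n f -> nderivable n g -> nderivable n (f \* g).
Proof.
elim: n f g => [|n IHn] f g.
  by move=> [df _] [dg _]; split=> // x; apply: derivableM.
move=> nf ng; have [df nf'] := nf; have [dg ng'] := ng.
apply: (@nderivable_is_derive _ _ (fun x => f x * derive1 g x + g x * derive1 f x)).
  by move=> x; apply: is_deriveM; exact: is_derive_derive1.
apply: nderivableD; apply: IHn => //; exact: nderivableW.
Qed.

Lemma is_derive_affine (k c x : R) : is_derive x 1 (fun y => k * y + c) k.
Proof.
have -> : (fun y => k * y + c) = (k \*: id) \+ cst c by [].
by apply: is_derive_eq; rewrite addr0 [_ *: _]mulr1.
Qed.

Lemma nderivable_affine n f (k c : R) :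
  nderivable n f -> nderivable n (fun x => f (k * x + c)).
Proof.
have comp x h : derivable h (k * x + c) 1 ->
    is_derive x 1 (fun y => h (k * y + c)) (k * derive1 h (k * x + c)).
  move=> dh; rewrite mulrC.
  apply: (@is_derive1_comp _ h (fun y => k * y + c)).
    exact: is_derive_derive1.
  exact: is_derive_affine.
elim: n f => [|n IHn] f.
  by move=> [df _]; split => // x; exact: (@ex_derive _ _ _ _ _ _ _ (comp x f (df _))).
move=> [df nf]; apply: nderivable_is_derive (nderivableZ k (IHn _ nf)) => x.
exact: comp.
Qed.

Lemma smooth_is_derive f f' : (forall x : R, is_derive x 1 f (f' x)) ->
  smooth f' -> smooth f.
Proof.
move=> dff' sf' n; apply: nderivableW; exact: nderivable_is_derive (sf' n).
Qed.

Lemma smoothM f g : smooth f -> smooth g -> smooth (f \* g).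
Proof. by move=> sf sg n; apply: nderivableM. Qed.

Lemma smoothD f g : smooth f -> smooth g -> smooth (f \+ g).
Proof. by move=> sf sg n; apply: nderivableD. Qed.

Lemma smoothZ c f : smooth f -> smooth (fun x => c * f x).
Proof. by move=> sf n; apply: nderivableZ. Qed.

Lemma smooth_affine f (k c : R) : smooth f -> smooth (fun x => f (k * x + c)).
Proof. by move=> sf n; apply: nderivable_affine. Qed.

Lemma smooth_continuous f : smooth f -> continuous f.
Proof.
move=> sf x; apply/differentiable_continuous/derivable1_diffP.
by have [] := sf 0%N.
Qed.

(* The family [t^-k exp(-1/t)], [t > 0], is stable under differentiation up to
   linear combinations. *)
Definition flat k (t : R) : R :=
  if 0 < t then t^-1 ^+ k * expR (- t^-1) else 0.

Lemma flat_ge0 k t : 0 <= flat k t.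
Proof.
rewrite /flat; case: ifPn => // t0.
by rewrite mulr_ge0 ?expR_ge0// exprn_ge0// invr_ge0 ltW.
Qed.

(** With s = 1/t, the exponential series gives e^s >= s^(k+1)/(k+1)!, hence s^k e^(-s) <= (k+1)!/s.
    Being linear in t, the bound yields continuity at 0 for every k at once. *)
Lemma flat_le k t : flat k t <= k.+1`!%:R * `|t|.
Proof.
rewrite /flat; case: ifPn => [t0|_]; last by rewrite mulr_ge0.
rewrite expRN ler_pdivrMr ?expR_gt0// gtr0_norm//.
have tV : 0 <= t^-1 by rewrite invr_ge0 ltW.
have := expR_ge1Dxn k tV.
move/(le_trans (ler_wpDl ler01 (lexx _))).
rewrite ler_pdivrMr ?ltr0n ?fact_gt0// => h.
have -> : t^-1 ^+ k = t * t^-1 ^+ k.+1 by rewrite exprS mulrA divff ?mul1r// gt_eqF.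
by rewrite (mulrC _ t) -mulrA ler_pM2l// mulrC.
Qed.

Lemma flat_cvg0 k : {for 0, continuous (flat k)}.
Proof.
have flat0 : flat k 0 = 0 by rewrite /flat ltxx.
suff : flat k t @[t --> 0] --> (0 : R) by rewrite -[X in _ --> X]flat0.
apply/norm_cvg0P.
apply: (@squeeze_cvgr _ _ _ _ (cst 0) (fun t : R => k.+1`!%:R * `|t|)).
- by near=> t; rewrite normr_ge0 ger0_norm ?flat_ge0 ?flat_le.
- exact: cvg_cst.
- rewrite -[X in _ --> X](mulr0 k.+1`!%:R); apply: cvgMr.
  by rewrite -[X in _ --> X](@normr0 _ R); apply: cvg_norm; exact: cvg_id.
Unshelve. all: by end_near. Qed.

Lemma is_derive_flat k (t : R) :
  is_derive t 1 (flat k) (- k%:R * flat k.+1 t + flat k.+2 t).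
Proof.
have [t0|t0|->] := ltgtP t 0.
- apply: (@near_eq_is_derive _ _ _ (cst 0)).
    near=> s; rewrite /flat ifF//; apply/negbTE; rewrite -leNgt ltW//.
    by near: s; exact: lt_nbhsl.
  rewrite /flat ltNge (ltW t0)/= mulr0 addr0; exact: is_derive_cst.
- apply: (@near_eq_is_derive _ _ _ (fun s : R => s^-1 ^+ k * expR (- s^-1))).
    near=> s; rewrite /flat ifT//.
    by near: s; exact: lt_nbhsr.
  have dV : is_derive t 1 (fun s : R => s^-1) (- t ^- 2).
    apply: is_derive_eq; first by apply: (@is_deriveV _ id); rewrite gt_eqF.
    exact: mulr1.
  have dE : is_derive t 1 (fun s : R => expR (- s^-1)) (expR (- t^-1) * t ^- 2).
    apply: (@is_derive1_comp _ expR (fun s : R => - s^-1)).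
    by rewrite -[X in is_derive _ _ _ X](opprK); exact: is_deriveN.
  have dX : is_derive t 1 (fun s : R => s^-1 ^+ k) (- k%:R * t^-1 ^+ k.+1).
    apply: is_derive_eq.
      have -> : (fun s : R => s^-1 ^+ k) = (fun s : R => s^-1) ^+ k.
        by apply/funext => s; rewrite exprfctE.
      exact: is_deriveX.
    rewrite -[LHS]/(k%:R * t^-1 ^+ k.-1 * (- t ^- 2)) -exprVn.
    case: (k) => [|m]; first by rewrite oppr0 !mul0r.
    by rewrite [m.+1.-1]/= !exprS; ring.
  have dM := is_deriveM dX dE; 
  set F := (fun s : R => _ * _).
  have FE : F = (fun s : R => s^-1 ^+ k) * (fun s : R => expR (- s^-1)) by [].
  rewrite FE; apply: (is_derive_eq dM).
  rewrite /flat t0 -exprVn.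
  set s := t^-1; set E := expR _.
  rewrite -[LHS]/(s ^+ k * (E * s ^+ 2) + E * (- k%:R * s ^+ k.+1)) !exprS; ring.
(* The difference quotient of [flat k] at 0 is [flat k.+1], so the Carathéodory criterion reduces
   differentiability at 0 to the continuity of [flat k.+1] there. *)
- apply/is_derive1_caratheodory; exists (flat k.+1); split.
  + move=> z; rewrite /flat ltxx !subr0; case: ifPn => z0; last by rewrite mul0r.
    by rewrite exprSr -!mulrA (mulrCA z^-1) mulVf ?mulr1// gt_eqF.
  + exact: flat_cvg0.
  + by rewrite /flat ltxx mulr0 addr0.
Unshelve. all: by end_near. Qed.

Lemma smooth_flat k : smooth (flat k).
Proof.
move=> n; elim: n k => [|n IHn] k.
  by split=> // t; exact: (@ex_derive _ _ _ _ _ _ _ (is_derive_flat k t)).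
apply: nderivable_is_derive (is_derive_flat k) _.
by apply: nderivableD => //; exact: nderivableZ.
Qed.

End smooth.

(** * Charges and their total variation *)

Section measure_integral.
Context d (T : measurableType d) (R : realType).
Implicit Types (mu : {measure set T -> \bar R}) (D : set T).

Lemma Rintegral_cvg mu D (f_ : (T -> R)^nat) (f g : T -> R) : measurable D ->
  (forall n, measurable_fun D (f_ n)) -> mu.-integrable D (EFin \o g) ->
  (forall x, D x -> f_ n x @[n --> \oo] --> f x) ->
  (forall n x, D x -> `|f_ n x| <= g x) ->
  \int[mu]_(x in D) f_ n x @[n --> \oo] --> \int[mu]_(x in D) f x.
Proof.
move=> mD mf_ ig f_f f_g.
have mf : measurable_fun D f by exact: measurable_fun_cvg mf_ f_f.
have mEf n : measurable_fun D (EFin \o f_ n) by exact/measurable_EFinP.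
have f_fE x : D x -> (EFin \o f_ n) x @[n --> \oo] --> (EFin \o f) x.
  by move=> Dx; apply: cvg_EFin; [exact: nearW|exact: f_f].
have gfin x : D x -> (EFin \o g) x \is a fin_num by [].
have cv := dominated_cvg mD mEf f_fE gfin ig f_g.
apply: fine_cvg; rewrite fineK; first exact: cv.
apply: integrable_fin_num => //.
apply: (le_integrable mD) ig; first exact/measurable_EFinP.
move=> x Dx; rewrite /= lee_fin (le_trans _ (ler_norm _))//.
have /cvg_norm fx := f_f x Dx.
apply: (closed_cvg (fun y : R => y <= g x)) fx; first exact: closed_le.
by apply: nearW => n; exact: f_g.
Qed.

Lemma integrableM_bounded mu D (g h : T -> R) (M : R) : measurable D ->
  mu.-integrable D (EFin \o g) -> measurable_fun D h ->
  (forall x, D x -> `|h x| <= M) ->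
  mu.-integrable D (fun x => (g x * h x)%:E).
Proof.
move=> mD ig mh hM.
have mg : measurable_fun D g by apply/measurable_EFinP; exact: measurable_int ig.
apply: (le_integrable _ _ _ (integrableZl _ M ig)) => //.
  by apply/measurable_EFinP; exact: measurable_funM.
move=> x Dx; rewrite /= lee_fin !normrM mulrC ler_wpM2r//.
by rewrite (le_trans (hM x Dx))// ler_norm.
Qed.

Lemma ge0_le_measure_integral_in (m1 m2 : {measure set T -> \bar R}) D
    (f : T -> \bar R) :
  measurable D -> measurable_fun D f -> (forall x, D x -> (0 <= f x)%E) ->
  (forall A, measurable A -> (m1 A <= m2 A)%E) ->
  (\int[m1]_(x in D) f x <= \int[m2]_(x in D) f x)%E.
Proof.
move=> mD mf f0 m12; rewrite integral_mkcond [leRHS]integral_mkcond.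
apply: ge0_le_measure_integral => //.
- by apply: erestrict_ge0.
- by apply/(measurable_restrictT _ mD).1.
Qed.

Lemma Rintegral_measure_add (m1 m2 : {measure set T -> \bar R}) D (f : T -> R) :
  measurable D -> m1.-integrable D (EFin \o f) -> m2.-integrable D (EFin \o f) ->
  \int[measure_add m1 m2]_(x in D) f x =
  \int[m1]_(x in D) f x + \int[m2]_(x in D) f x.
Proof.
move=> mD if1 if2; rewrite /Rintegral integral_measure_add//.
by rewrite fineD//; exact: integrable_fin_num.
Qed.

End measure_integral.

(** Turns an equality of differences, the natural form for signed measures, into an equality of
    sums, which positive measures can express. *)
Lemma eqe_subLR_addLR (R : numDomainType) (x y z t : \bar R) :
  x \is a fin_num -> y \is a fin_num -> z \is a fin_num -> t \is a fin_num ->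
  (x - y = z - t -> x + t = z + y)%E.
Proof.
move: x y z t => [x| |] [y| |] [z| |] [t| |]//= _ _ _ _ [xyzt].
by congr EFin; rewrite -(subrK y x) xyzt addrAC subrK.
Qed.

Section charge_integral.
Context d (T : measurableType d) (R : realType).
Variable nu : {charge set T -> \bar R}.
Implicit Type (D A : set T).

Local Notation pos := (jordan_pos (hahnP nu)).
Local Notation neg := (jordan_neg (hahnP nu)).

Lemma measurable_hahn_pos : measurable (hahn_pos nu).
Proof. by have [[]] := hahnP nu. Qed.

Lemma measurable_hahn_neg : measurable (hahn_neg nu).
Proof. by have [_ []] := hahnP nu. Qed.

Lemma jordan_pos_setI A : measurable A -> pos A = nu (A `&` hahn_pos nu).
Proof. by move=> mA; rewrite jordan_posE cjordan_posE /crestr0 mem_set. Qed.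

Lemma jordan_neg_setI A : measurable A -> neg A = (- nu (A `&` hahn_neg nu))%E.
Proof. by move=> mA; rewrite jordan_negE cjordan_negE /crestr0 mem_set. Qed.

Lemma jordan_decompE A : measurable A -> (nu A = pos A - neg A)%E.
Proof.
by move=> mA; rewrite (jordan_decomp (hahnP nu) mA) /cadd/= cscaleN1.
Qed.

Lemma charge_total_variationE A : measurable A ->
  (charge_total_variation nu A = nu (A `&` hahn_pos nu) - nu (A `&` hahn_neg nu))%E.
Proof.
by move=> mA; rewrite -jordan_pos_setI// -jordan_neg_setI.
Qed.

Lemma charge_total_variation_fin A : measurable A ->
  charge_total_variation nu A \is a fin_num.
Proof.
move=> mA; rewrite [charge_total_variation nu A]/(pos A + neg A)%E.
by rewrite fin_numD !fin_num_measure.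
Qed.

Lemma le_normr_charge_total_variation A : measurable A ->
  `|fine (nu A)| <= fine (charge_total_variation nu A).
Proof.
move=> mA; rewrite -lee_fin fineK ?charge_total_variation_fin//.
have := abse_charge_variation (hahnP nu) mA.
by rewrite -[in X in X -> _](fineK (fin_num_measure nu _ mA)).
Qed.

(** No cancellation can hide in an atom: a singleton meets each Hahn half either in itself or not at
    all. *)
Lemma charge_total_variation_set1 x : measurable [set x] ->
  nu [set x] = 0%E -> charge_total_variation nu [set x] = 0%E.
Proof.
move=> mx nux0; rewrite charge_total_variationE//.
have nuxI A : nu ([set x] `&` A) = 0%E.
  have [Ax|Ax] := pselect (A x); first by rewrite setIidl// => _ ->.
  rewrite (_ : _ `&` _ = set0) ?charge0//.
  by apply/seteqP; split=> // y [/= -> /Ax].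
by rewrite !nuxI sube0.
Qed.

Lemma bounded_integrable (mu : {finite_measure set T -> \bar R}) D (f : T -> R) M :
  measurable D -> measurable_fun D f -> (forall x, D x -> `|f x| <= M) ->
  mu.-integrable D (EFin \o f).
Proof.
move=> mD mf fM; apply: (le_integrable mD) (finite_measure_integrable_cst mu M mD).
- exact/measurable_EFinP.
- by move=> x Dx; rewrite /= lee_fin (le_trans (fM x Dx))// ler_norm.
Qed.

Lemma charge_Rintegral_cvg D (f_ : (T -> R)^nat) (f : T -> R) (M : R) :
  measurable D -> (forall n, measurable_fun D (f_ n)) ->
  (forall x, D x -> f_ n x @[n --> \oo] --> f x) ->
  (forall n x, D x -> `|f_ n x| <= M) ->
  charge_Rintegral nu D (f_ n) @[n --> \oo] --> charge_Rintegral nu D f.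
Proof.
move=> mD mf_ f_f f_M; apply: cvgB.
- apply: (@Rintegral_cvg _ _ _ pos D f_ f (cst M)) => //.
  exact: finite_measure_integrable_cst.
- apply: (@Rintegral_cvg _ _ _ neg D f_ f (cst M)) => //.
  exact: finite_measure_integrable_cst.
Qed.

(** Cross-adding gives pos + m2 = m1 + neg as measures on [D], and integrals against positive
    measures add. This frees the integral from the Hahn decomposition, which does not behave well
    under sums and scalings of charges. *)
Lemma charge_RintegralE (m1 m2 : {finite_measure set T -> \bar R}) D
    (f : T -> R) (M : R) :
  measurable D -> measurable_fun D f -> (forall x, D x -> `|f x| <= M) ->
  (forall A, measurable A -> A `<=` D -> (nu A = m1 A - m2 A)%E) ->
  charge_Rintegral nu D f =
  \int[m1]_(x in D) f x - \int[m2]_(x in D) f x.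
Proof.
move=> mD mf fM num.
have fi (mu : {finite_measure set T -> \bar R}) : mu.-integrable D (EFin \o f).
  exact: bounded_integrable fM.
have : \int[measure_add pos m2]_(x in D) f x =
    \int[measure_add m1 neg]_(x in D) f x.
  congr fine; apply: eq_measure_integral => A mA AD.
  rewrite [LHS]measure_addE [RHS]measure_addE.
  apply: eqe_subLR_addLR; rewrite ?fin_num_measure//.
  by rewrite -num// jordan_decompE.
rewrite !Rintegral_measure_add//; [|exact: fi..].
by rewrite /charge_Rintegral; lra.
Qed.

Lemma charge_Rintegral_set1 D x : measurable [set x] -> measurable D -> D x ->
  charge_Rintegral nu D \1_[set x] = fine (nu [set x]).
Proof.
move=> mx mD Dx; rewrite /charge_Rintegral /Rintegral !integral_indic//.
rewrite setIidl => [|_ -> //].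
rewrite -fineB ?fin_num_measure//.
by rewrite [in RHS]jordan_decompE.
Qed.

End charge_integral.

Section measure_add_finite.
Context d (T : measurableType d) (R : realType).
Variables m1 m2 : {finite_measure set T -> \bar R}.

Let measure_add_fin : fin_num_fun (measure_add m1 m2).
Proof. by move=> A mA; rewrite measure_addE fin_numD !fin_num_measure. Qed.

(** Lets sums of Jordan parts serve as the finite measures in [charge_RintegralE]. *)
HB.instance Definition _ := Measure.copy (measure_add m1 m2)
  (msum (fun n => if n is 0%N then m1 : {measure set T -> \bar R} else m2) 2).

HB.instance Definition _ :=
  @Measure_isFinite.Build _ _ _ (measure_add m1 m2) measure_add_fin.

End measure_add_finite.

Section charge_integral_linear.
Context d (T : measurableType d) (R : realType).
Implicit Types (nu : {charge set T -> \bar R}) (D : set T) (f : T -> R) (M : R).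

Lemma eqe_addB (a b c e : \bar R) :
  a \is a fin_num -> b \is a fin_num -> c \is a fin_num -> e \is a fin_num ->
  (a - b + (c - e) = a + c - (b + e))%E.
Proof.
move: a b c e => [a| |] [b| |] [c| |] [e| |]//= _ _ _ _.
by congr EFin; rewrite opprD addrACA.
Qed.

Lemma charge_Rintegral_cadd nu1 nu2 D f M :
  measurable D -> measurable_fun D f -> (forall x, D x -> `|f x| <= M) ->
  charge_Rintegral (cadd nu1 nu2) D f =
  charge_Rintegral nu1 D f + charge_Rintegral nu2 D f.
Proof.
move=> mD mf fM.
rewrite (@charge_RintegralE _ _ _ _
  (measure_add (jordan_pos (hahnP nu1)) (jordan_pos (hahnP nu2)))
  (measure_add (jordan_neg (hahnP nu1)) (jordan_neg (hahnP nu2))) _ _ M)//.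
  rewrite !Rintegral_measure_add//; [|exact: bounded_integrable fM..].
  by rewrite /charge_Rintegral; lra.
move=> A mA _; transitivity (nu1 A + nu2 A)%E => //.
rewrite (jordan_decompE nu1)// (jordan_decompE nu2)//.
rewrite eqe_addB ?fin_num_measure//.
by congr (_ - _)%E; rewrite [RHS]measure_addE.
Qed.

Lemma Rintegral_mscale (k : {nonneg R}) (mu : {measure set T -> \bar R}) D f :
  measurable D -> mu.-integrable D (EFin \o f) ->
  \int[mscale k mu]_(x in D) f x = k%:num * \int[mu]_(x in D) f x.
Proof.
move=> mD fi; have mEf := measurable_int _ fi.
have fin (g : T -> \bar R) : mu.-integrable D g ->
  (\int[mu]_(x in D) g x)%E \is a fin_num by exact: integrable_fin_num.
rewrite /Rintegral -[RHS]/(fine k%:num%:E * _) -fineM//; last exact: fin.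
congr fine; rewrite integralE [in RHS]integralE.
rewrite !ge0_integral_mscale//.
rewrite -muleBr// fin_num_adde_defr//.
by apply/fin/integrable_funepos.
- exact: measurable_funeneg.
- exact: measurable_funepos.
Qed.

Lemma charge_Rintegral_cscale c nu D f M :
  measurable D -> measurable_fun D f -> (forall x, D x -> `|f x| <= M) ->
  charge_Rintegral (cscale c nu) D f = c * charge_Rintegral nu D f.
Proof.
move=> mD mf fM.
have fi (mu : {finite_measure set T -> \bar R}) : mu.-integrable D (EFin \o f).
  exact: bounded_integrable fM.
have Rscale k (mu : {finite_measure set T -> \bar R}) :=
  Rintegral_mscale k mD (fi mu).
pose k := NngNum (normr_ge0 c).
have cnuE A : measurable A -> cscale c nu A =
    (c%:E * (jordan_pos (hahnP nu) A - jordan_neg (hahnP nu) A))%E.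
  by move=> mA; rewrite -jordan_decompE.
have mulB A (e : R) : measurable A ->
    (e%:E * (jordan_pos (hahnP nu) A - jordan_neg (hahnP nu) A) =
     e%:E * jordan_pos (hahnP nu) A - e%:E * jordan_neg (hahnP nu) A)%E.
  by move=> mA; rewrite muleBr// fin_num_adde_defr// fin_num_measure.
have [c0|c0] := leP 0 c.
  rewrite (@charge_RintegralE _ _ _ _ (mscale k (jordan_pos (hahnP nu)))
    (mscale k (jordan_neg (hahnP nu))) _ _ M)//.
    by rewrite !Rscale/= ger0_norm// /charge_Rintegral; ring.
  move=> A mA _; apply: (etrans (cnuE A mA)); rewrite mulB//.
  by rewrite -[in LHS](ger0_norm c0).
(* For c < 0 the scaling exchanges the two Jordan parts, each weighted by |c|. *)
rewrite (@charge_RintegralE _ _ _ _ (mscale k (jordan_neg (hahnP nu)))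
  (mscale k (jordan_pos (hahnP nu))) _ _ M)//.
  by rewrite !Rscale/= ltr0_norm// /charge_Rintegral; ring.
move=> A mA _; apply: (etrans (cnuE A mA)).
have cE : c = - `|c| by rewrite ltr0_norm// opprK.
rewrite {1}cE EFinN mulNe mulB// oppeB; last first.
  by rewrite fin_num_adde_defr// fin_numM// fin_num_measure.
by rewrite addeC.
Qed.

Lemma charge_Rintegral_dirac p D f M :
  measurable D -> measurable_fun D f -> (forall x, D x -> `|f x| <= M) ->
  D p -> charge_Rintegral (charge_of_finite_measure (dirac p)) D f = f p.
Proof.
move=> mD mf fM Dp.
rewrite (@charge_RintegralE _ _ _ _ (dirac p) mzero _ _ M)//.
  rewrite /Rintegral integral_dirac//; last exact/measurable_EFinP.
  by rewrite diracE mem_set// mul1e integral_measure_zero subr0.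
by move=> A mA _; rewrite /mzero sube0.
Qed.

End charge_integral_linear.

(** * Moving mass away from an atom of a charge *)

Section kink.
Context d (T : measurableType d) (R : realType).
Variables (nu : {charge set T -> \bar R}) (t : R) (p x q : T).
Implicit Types (A D : set T).

Definition dirac_charge (y : T) : {charge set T -> \bar R} :=
  charge_of_finite_measure (dirac y).

(** With p = x - r and q = x + r, the added charge is the distributional derivative of t times
    [kink_step]; it is kept abstract here because the variation estimate uses no order on [T]. *)
Definition add_kink : {charge set T -> \bar R} :=
  cadd nu (cscale t (cadd (cadd (dirac_charge p) (dirac_charge q))
                          (cscale (-2) (dirac_charge x)))).

Lemma add_kinkE A : (add_kink A =
  nu A + (t * ((p \in A)%:R + (q \in A)%:R - 2 * (x \in A)%:R))%:E)%E.
Proof.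
transitivity (nu A + t%:E *
    (\d_p A + \d_q A + (- 2)%:E * \d_x A))%E; first by [].
by rewrite !diracE -mulNr.
Qed.

Lemma charge_Rintegral_add_kink D (f : T -> R) M :
  measurable D -> measurable_fun D f -> (forall x, D x -> `|f x| <= M) ->
  D p -> D x -> D q ->
  charge_Rintegral add_kink D f =
  charge_Rintegral nu D f + t * (f p + f q - 2 * f x).
Proof.
move=> mD mf fM Dp Dx Dq.
rewrite (charge_Rintegral_cadd _ _ mD mf fM) (charge_Rintegral_cscale _ _ mD mf fM).
rewrite 2!(charge_Rintegral_cadd _ _ mD mf fM) (charge_Rintegral_cscale _ _ mD mf fM).
by rewrite !(charge_Rintegral_dirac mD mf fM)// mulNr.
Qed.

(* By the sign condition the perturbed charge keeps the sign of [nu] at [x], so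
   that [x] is on the side of its Hahn decomposition on which moving the mass
   [2t] away from [x] saves exactly [2|t|]. *)
Lemma charge_total_variation_add_kink A :
  measurable A -> measurable [set x] -> p != x -> q != x ->
  0 < t * fine (nu [set x]) -> `|2 * t| < `|fine (nu [set x])| ->
  (charge_total_variation add_kink A + (`|t| * (2 * (x \in A)%:R))%:E <=
   charge_total_variation nu A + (`|t| * ((p \in A)%:R + (q \in A)%:R))%:E)%E.
Proof.
move=> mA mx px qx tm0 tm.
set P := hahn_pos add_kink; set N := hahn_neg add_kink.
have mP : measurable P by exact: measurable_hahn_pos.
have mN : measurable N by exact: measurable_hahn_neg.
have [posP negN PNT PN0] := hahnP add_kink; rewrite -/P -/N in posP negN PNT PN0.
have nufin B : measurable B -> nu B = (fine (nu B))%:E.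
  by move=> mB; rewrite fineK// fin_num_measure.
have inPN y : (y \in N) = ~~ (y \in P).
  apply/idP/idP; rewrite ?notin_setE !inE.
    by move=> Ny Py; have : (P `&` N) y by []; rewrite PN0.
  by move=> Py; have : [set: T] y by []; rewrite -PNT => -[].
have tvAPN : (charge_total_variation nu A = charge_total_variation nu (A `&` P) +
    charge_total_variation nu (A `&` N))%E.
  rewrite -measureU//; [|exact: measurableI..|].
    by rewrite -setIUr PNT setIT.
  by rewrite setIACA PN0 setI0.
have xP : (x \in P) = (0 < t).
  have kx : add_kink [set x] = (fine (nu [set x]) - 2 * t)%:E.
    have memx y : (y \in [set x]) = (y == x) by apply/idP/eqP; rewrite inE.
    rewrite add_kinkE (nufin _ mx) !memx (negbTE px) (negbTE qx) eqxx.
    apply: (congr1 EFin (_ : _ + _ = _ - _)) => /=; ring.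
  move: tm0 tm kx; set m := fine _ => tm0 tm kx.
  have [t0|t0|t0] := ltgtP 0 t; last by rewrite -t0 mul0r ltxx in tm0.
  - have m0 : 0 < m by rewrite -(pmulr_rgt0 _ t0).
    apply/negPn/negP; rewrite -inPN inE => Nx.
    have := negN.2 [set x] mx; rewrite kx lee_fin => /(_ (ltac:(by move=> y ->))).
    by rewrite !gtr0_norm// in tm; lra.
  - have m0 : m < 0 by rewrite -(nmulr_rgt0 _ t0).
    apply/negP; rewrite inE => Px.
    have := posP.2 [set x] mx; rewrite kx lee_fin => /(_ (ltac:(by move=> y ->))).
    by rewrite !ltr0_norm// in tm; lra.
have mAP : measurable (A `&` P) by exact: measurableI.
have mAN : measurable (A `&` N) by exact: measurableI.
(* Unprimed booleans tell which points lie in [A], primed ones whether p and q lie in [P]; for x the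
   latter is 0 < t. On its side x contributes exactly -2|t|, while p and q contribute t or -t
   according to their side, hence at most |t| each. *)
have claim (cP cN vP vN : R) (bp bq bx bp' bq' : bool) : `|cP| <= vP -> `|cN| <= vN ->
    cP + t * ((bp && bp')%:R + (bq && bq')%:R - 2 * (bx && (0 < t))%:R) -
    (cN + t * ((bp && ~~ bp')%:R + (bq && ~~ bq')%:R - 2 * (bx && ~~ (0 < t))%:R)) +
    `|t| * (2 * bx%:R) <= vP + vN + `|t| * (bp%:R + bq%:R).
  rewrite !ler_norml => /andP[h1 h2] /andP[h3 h4].
  have [t0|t0] := ltP 0 t; [rewrite (gtr0_norm t0)|rewrite (ler0_norm t0)];
  by case: bp; case: bq; case: bx; case: bp'; case: bq' => /=; lra.
rewrite tvAPN (charge_total_variationE add_kink mA) -/P -/N !add_kinkE (nufin _ mAP) (nufin _ mAN).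
rewrite -(fineK (charge_total_variation_fin nu mAP)).
rewrite -(fineK (charge_total_variation_fin nu mAN)).
rewrite !in_setI !inPN xP.
have := claim _ _ _ _ (p \in A) (q \in A) (x \in A) (p \in P) (q \in P)
  (le_normr_charge_total_variation nu mAP) (le_normr_charge_total_variation nu mAN).
by rewrite -lee_fin.
Qed.

(** Written without subtraction, the set inequality compares two positive measures: the new
    variation plus |t| times twice the Dirac mass at x, and the old one plus |t| times the Dirac
    masses at p and q. A nonnegative integrand preserves this order, even if the integrals are
    infinite. *)
Lemma integral_add_kink_le D (g : T -> R) :
  measurable D -> measurable_fun D g -> (forall y, D y -> 0 <= g y) ->
  D p -> D x -> D q ->
  measurable [set x] -> p != x -> q != x ->
  0 < t * fine (nu [set x]) -> `|2 * t| < `|fine (nu [set x])| ->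
  (\int[charge_total_variation add_kink]_(y in D) (g y)%:E +
     (`|t| * (2 * g x))%:E <=
   \int[charge_total_variation nu]_(y in D) (g y)%:E +
     (`|t| * (g p + g q))%:E)%E.
Proof.
move=> mD mg g0 Dp Dx Dq mx px qx tm0 tm.
have mEg : measurable_fun D (EFin \o g) by exact/measurable_EFinP.
have Eg0 y : D y -> (0 <= (g y)%:E)%E by move=> Dy; rewrite lee_fin g0.
pose k := NngNum (normr_ge0 t).
have integral_two_dirac y z (mu : {measure set T -> \bar R}) : D y -> D z ->
    (\int[measure_add mu (mscale k (measure_add (dirac y) (dirac z)))]_(w in D)
        (g w)%:E =
     \int[mu]_(w in D) (g w)%:E + (`|t| * (g y + g z))%:E)%E.
  move=> Dy Dz; rewrite ge0_integral_measure_add// ge0_integral_mscale//.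
  rewrite ge0_integral_measure_add// !integral_dirac//.
  by rewrite !diracE !mem_set// !mul1e.
have := @ge0_le_measure_integral_in _ _ _
  (measure_add (charge_total_variation add_kink)
    (mscale k (measure_add (dirac x) (dirac x))))
  (measure_add (charge_total_variation nu)
    (mscale k (measure_add (dirac p) (dirac q)))) D (EFin \o g) mD mEg Eg0.
rewrite !integral_two_dirac// mulr_natl mulr2n; apply => A mA.
have two_diracE (mu : {measure set T -> \bar R}) y z :
    measure_add mu (mscale k (measure_add (dirac y) (dirac z))) A =
    (mu A + (`|t| * ((y \in A)%:R + (z \in A)%:R))%:E)%E.
  rewrite measure_addE; congr (_ + _)%E.
  transitivity (`|t|%:E * (\d_y A + \d_z A))%E; last by rewrite !diracE.
  by congr (_ * _)%E; exact: measure_addE.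
have := charge_total_variation_add_kink mA mx px qx tm0 tm.
by rewrite [2 * _]mulr_natl mulr2n -!two_diracE.
Qed.

End kink.

(** * Tent functions and jumps of functions of bounded variation *)

Section plateau.
Context {R : realType}.
Implicit Types (c d y : R) (n : nat).

(* Converges to the indicator of [`]c, d[] since [flat 0] tends to 1 at
   infinity. *)
Definition plateau c d n y : R :=
  flat 0 (n.+1%:R * y + - n.+1%:R * c) * flat 0 (- n.+1%:R * y + n.+1%:R * d).

Lemma flat0_le1 (t : R) : flat 0 t <= 1.
Proof.
rewrite /flat; case: ifPn => // t0; rewrite expr0 mul1r.
by rewrite -[leRHS]expR0 ler_expR oppr_le0 invr_ge0 ltW.
Qed.

Lemma smooth_plateau c d n : smooth (plateau c d n).
Proof. by apply: smoothM; apply: smooth_affine; exact: smooth_flat. Qed.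

Lemma plateau_ge0 c d n y : 0 <= plateau c d n y.
Proof. by rewrite mulr_ge0// flat_ge0. Qed.

Lemma plateau_le1 c d n y : plateau c d n y <= 1.
Proof. by rewrite -[leRHS]mulr1 ler_pM ?flat_ge0 ?flat0_le1. Qed.

Lemma plateau_eq0 c d n y : ~ `]c, d[%classic y -> plateau c d n y = 0.
Proof.
rewrite /= in_itv/= => /negP; rewrite negb_and -!leNgt /plateau /flat.
have n0 : 0 < n.+1%:R :> R by [].
case/orP => [yc|dy].
  by rewrite ifF ?mul0r//; apply/negbTE; rewrite -leNgt mulNr -mulrBr pmulr_rle0// subr_le0.
rewrite [X in _ * X]ifF ?mulr0//; apply/negbTE; rewrite -leNgt mulNr addrC -mulrBr.
by rewrite pmulr_rle0// subr_le0.
Qed.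

Lemma flat0_cvg1 (t : R) : 0 < t -> flat 0 (n.+1%:R * t) @[n --> \oo] --> (1 : R).
Proof.
move=> t0.
have -> : (fun n => flat 0 (n.+1%:R * t)) = (fun n => expR (- (t^-1 * n.+1%:R^-1))).
  apply/funext => n; rewrite /flat mulr_gt0// expr0 mul1r invfM.
  by rewrite mulrC.
rewrite -[X in _ --> X]expR0; apply: continuous_cvg; first exact: continuous_expR.
rewrite -[X in _ --> X]oppr0; apply: cvgN; rewrite -[X in _ --> X](mulr0 t^-1); apply: cvgMr.
exact: (@cvg_harmonic R).
Qed.

Lemma plateau_cvg c d y : plateau c d n y @[n --> \oo] --> (\1_`]c, d[ y : R).
Proof.
rewrite indicE; case: (boolP (y \in _)); rewrite ?notin_setE ?inE => /= yI; last first.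
  under eq_fun do rewrite plateau_eq0//.
  exact: cvg_cst.
move: yI; rewrite in_itv/= => /andP[cy yd].
rewrite -(mulr1 1); apply: cvgM.
  under eq_fun do rewrite mulNr -mulrBr.
  by apply: flat0_cvg1; rewrite subr_gt0.
under eq_fun do rewrite mulNr addrC -mulrBr.
by apply: flat0_cvg1; rewrite subr_gt0.
Qed.

End plateau.

(** * Primitives of functions lying between 0 and the indicator of a bounded interval *)

Section primitive.
Context {R : realType}.
Local Notation mu := (@lebesgue_measure R).
Implicit Types (c d y : R) (f : R -> R).

Definition primitive f y : R := \int[mu]_(z in `]-oo, y]) f z.

Section bounded_support.
Variables (c d : R) (f : R -> R).
Hypotheses (cd : c <= d) (mf : measurable_fun setT f).
Hypotheses (f0 : forall y, 0 <= f y) (f1 : forall y, f y <= \1_`]c, d[ y).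

Lemma bounded_support_eq0 y : ~ `]c, d[%classic y -> f y = 0.
Proof.
move=> ycd; apply/eqP; rewrite eq_le f0 andbT (le_trans (f1 y))// indicE.
by rewrite memNset.
Qed.

Lemma bounded_support_integrable : mu.-integrable setT (EFin \o f).
Proof.
apply: (le_integrable _ _ _ (integrable_indic_itv c d false true)) => //.
  exact/measurable_EFinP.
move=> y _; rewrite /= lee_fin ger0_norm// (le_trans (f1 y))//.
exact: ler_norm.
Qed.

Lemma primitive_mkcond y : primitive f y = \int[mu]_z (f \_ `]-oo, y]) z.
Proof. exact: Rintegral_mkcond. Qed.

Lemma primitive_ge0 y : 0 <= primitive f y.
Proof. exact: Rintegral_ge0. Qed.

Lemma Rintegral_indic_itv : \int[mu]_z \1_`]c, d[ z = d - c.
Proof.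
rewrite /Rintegral integral_indic//.
rewrite setIT.
have muE : mu `]c, d[ = if c < d then (d - c)%:E else 0%E.
  by have := lebesgue_measure_itv `]c, d[; rewrite /= lte_fin => ->.
transitivity (fine (mu `]c, d[)); first by [].
by rewrite muE; case: ltgtP cd => //= -> _; rewrite subrr.
Qed.

Lemma primitive_le y : primitive f y <= d - c.
Proof.
rewrite primitive_mkcond -Rintegral_indic_itv; apply: le_Rintegral => //.
- rewrite -restrict_EFin; apply/integrable_restrict => //=; rewrite setTI.
  by apply: integrableS bounded_support_integrable.
- exact: integrable_indic_itv.
- by move=> z _; rewrite /patch; case: ifPn => // _; rewrite indicE.
Qed.

Lemma primitive_left y : y <= c -> primitive f y = 0.
Proof.
move=> yc; rewrite /primitive (@eq_Rintegral _ _ _ _ _ (cst 0)).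
  by rewrite Rintegral_cst// mul0r.
move=> z; rewrite inE/= in_itv/= => zy; apply: bounded_support_eq0.
by rewrite /= in_itv/= ltNge (le_trans zy yc).
Qed.

Lemma primitive_right y : d <= y -> primitive f y = primitive f d.
Proof.
move=> dy; rewrite !primitive_mkcond; congr (Rintegral _ _ _).
apply/funext => z; rewrite /patch !mem_setE !in_itv/=.
have [zd|dz] := leP z d; first by rewrite (le_trans zd dy).
case: ifPn => // _; apply: bounded_support_eq0.
by rewrite /= in_itv/= (ltNge z) (ltW dz) andbF.
Qed.

Lemma is_derive_primitive y : {for y, continuous f} ->
  is_derive y 1 (primitive f) (f y).
Proof.
move=> cf; have yy1 : y < y + 1 by rewrite ltrDl.
have fi : mu.-integrable `]-oo, y + 1] (EFin \o f).
  exact: integrableS bounded_support_integrable.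
have df : derivable (primitive f) y 1.
  by apply: (continuous_FTC1 yy1 fi _ cf).1; rewrite /= ltNyr.
have <- : derive1 (primitive f) y = f y.
  by apply: (continuous_FTC1 yy1 fi _ cf).2; rewrite /= ltNyr.
exact: is_derive_derive1.
Qed.

End bounded_support.

End primitive.

Section tent.
Context {R : realType}.
Local Notation mu := (@lebesgue_measure R).
Variables (x r : R).
Hypothesis r0 : 0 < r.
Implicit Types (y : R) (n : nat).

Definition kink_step y : R := \1_`]x - r, x[ y - \1_`]x, x + r[ y.

(* For [f] the indicator of [`]x - r, x[], the tent of height [r] over
   [`]x - r, x + r[], whose slope is [kink_step]. *)
Definition tent_of (f : R -> R) y : R := primitive f y - primitive f (y - r).

Definition tent := tent_of \1_`]x - r, x[.

Definition smooth_tent n := tent_of (plateau (x - r) x n).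

Let xr : x - r <= x. Proof. by rewrite gerBl ltW. Qed.

Section tent_of_bounded.
Variable f : R -> R.
Hypotheses (mf : measurable_fun setT f) (f0 : forall y, 0 <= f y).
Hypothesis f1 : forall y, f y <= \1_`]x - r, x[ y.

(** Both primitives lie in [0, r], since [f] is below the indicator of an interval of length r. The
    bound is the same for every such [f], so it dominates all the smooth tents together with their
    limit. *)
Lemma normr_tent_of_le y : `|tent_of f y| <= r.
Proof.
have pr z : 0 <= primitive f z <= r.
  rewrite primitive_ge0//= -[leRHS](subKr x).
  exact: (primitive_le xr).
rewrite ler_norml /tent_of; have := pr y; have := pr (y - r).
by move=> /andP[? ?] /andP[? ?]; apply/andP; split; lra.
Qed.

(** Left of x - r both primitives vanish; right of x + r both y and y - r are past x, where the
    primitive is constant. *)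
Lemma tent_of_eq0 y : ~ `]x - r, x + r[%classic y -> tent_of f y = 0.
Proof.
rewrite /= in_itv/= => /negP; rewrite negb_and -!leNgt /tent_of => /orP[yx|xy].
  rewrite !(primitive_left f0 f1) ?subrr//.
  by rewrite (le_trans _ yx)// gerBl ltW.
rewrite (primitive_right f0 f1); last by rewrite (le_trans _ xy)// lerDl ltW.
by rewrite [X in _ - X](primitive_right f0 f1) ?subrr// lerBrDr.
Qed.

End tent_of_bounded.

Let mindic : measurable_fun setT (\1_`]x - r, x[ : R -> R).
Proof. exact: measurable_indic. Qed.

Let indic_ge0 y : 0 <= (\1_`]x - r, x[ y : R). Proof. by rewrite indicE. Qed.

Let mplateau n : measurable_fun setT (plateau (x - r) x n).
Proof. by apply: continuous_measurable_fun; apply: smooth_continuous; exact: smooth_plateau. Qed.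

Let plateau_le_indic n y : plateau (x - r) x n y <= \1_`]x - r, x[ y.
Proof.
rewrite indicE; case: (boolP (y \in _)); rewrite ?notin_setE ?inE => yI.
  exact: plateau_le1.
by rewrite plateau_eq0.
Qed.

Lemma tent_center : tent x = r.
Proof.
rewrite /tent /tent_of [X in _ - X](primitive_left indic_ge0 (fun=> lexx _))// subr0.
rewrite primitive_mkcond.
transitivity (\int[mu]_z \1_`]x - r, x[ z).
  congr (Rintegral _ _ _); apply/funext => z; rewrite /patch; case: ifPn => //.
  rewrite mem_setE in_itv/= -ltNge => xz; rewrite indicE memNset//=.
  by rewrite in_itv/= [X in _ && X]ltNge (ltW xz) andbF.
by rewrite Rintegral_indic_itv// subKr.
Qed.

Lemma smooth_tent_cvg y : smooth_tent n y @[n --> \oo] --> tent y.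
Proof.
have cv z : primitive (plateau (x - r) x n) z @[n --> \oo] --> primitive \1_`]x - r, x[ z.
  apply: (@Rintegral_cvg _ _ _ mu `]-oo, z] _ _ \1_`]x - r, x[) => //.
  - by move=> n; exact: measurable_funTS (mplateau n).
  - by apply: (integrableS _ _ _ (integrable_indic_itv (x - r) x false true)).
  - by move=> t _; exact: plateau_cvg.
  - by move=> n t _; rewrite ger0_norm ?plateau_ge0.
by apply: cvgB; exact: cv.
Qed.

Lemma indic_shift y : \1_`]x - r, x[ (y - r) = \1_`]x, x + r[ y :> R.
Proof.
by rewrite !indicE !mem_setE !in_itv/= ltrD2r ltrBlDr.
Qed.

Lemma is_derive_smooth_tent n y : is_derive y 1 (smooth_tent n)
  (plateau (x - r) x n y - plateau (x - r) x n (y - r)).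
Proof.
have dp (z : R) : is_derive z 1 (primitive (plateau (x - r) x n)) (plateau (x - r) x n z).
  apply: is_derive_primitive (mplateau n) (plateau_ge0 _ _ _) (plateau_le_indic n) _ _.
  by apply: smooth_continuous; exact: smooth_plateau.
apply: is_deriveB.
rewrite -[X in is_derive _ _ _ X]mulr1.
apply: (@is_derive1_comp _ (primitive (plateau (x - r) x n)) (fun z : R => z - r)) => //.
have := is_derive_affine 1 (- r) y.
by under eq_fun do rewrite mul1r.
Qed.

Lemma smooth_tent_smooth n : smooth (smooth_tent n).
Proof.
apply: smooth_is_derive (is_derive_smooth_tent n) _.
have sb := @smooth_plateau R (x - r) x n.
have -> : (fun y => plateau (x - r) x n y - plateau (x - r) x n (y - r)) =
    plateau (x - r) x n \+ (fun y => -1 * plateau (x - r) x n (1 * y + - r)).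
  by apply/funext => y /=; rewrite mulN1r mul1r.
by apply: smoothD => //; apply: smoothZ; exact: smooth_affine.
Qed.

(** The plateaus stay below the indicator of the open interval, so smoothing does not enlarge the
    support: one compact set serves for all n. *)
Lemma smooth_tent_test (a b : R) n : a < x - r -> x + r < b ->
  test_function `]a, b[ (smooth_tent n).
Proof.
move=> ax xb; split.
  by apply: smooth_derivable_derive1n; exact: smooth_tent_smooth.
exists `[x - r, x + r]%classic; split.
- exact: segment_compact.
- move=> y /=; rewrite !in_itv/= => /andP[xy yx].
  by rewrite (lt_le_trans ax xy) (le_lt_trans yx xb).
- move=> y ynI; apply: (tent_of_eq0 (plateau_ge0 _ _ _) (plateau_le_indic n)) => yI.
  by apply: ynI; apply: subset_itv_oo_cc yI.
Qed.

Section BV_tent.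
Variables (a b : R) (g : BV a b).
Hypotheses (ax : a < x - r) (xb : x + r < b).

(** Limit of the defining identity of [BV] along the smooth tents. On the left their slopes are
    bounded by 1, so |g| dominates; on the right the tents are bounded by r and the Jordan parts are
    finite. *)
Lemma BV_deriv_tent :
  \int[mu]_(y in `]a, b[) (g y * kink_step y) =
  - charge_Rintegral (BV_deriv g) `]a, b[ tent.
Proof.
have mg : measurable_fun `]a, b[ g.
  by apply/measurable_EFinP; exact: measurable_int (BV_integrable g).
pose G n := \int[mu]_(y in `]a, b[) (g y * derive1 (smooth_tent n) y).
have GE n : G n = - charge_Rintegral (BV_deriv g) `]a, b[ (smooth_tent n).
  by apply: BV_derivP; exact: smooth_tent_test.
have dE n y : derive1 (smooth_tent n) y = plateau (x - r) x n y - plateau (x - r) x n (y - r).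
  by rewrite derive1E (@derive_val _ _ _ _ _ _ _ (is_derive_smooth_tent n y)).
have G1 : G n @[n --> \oo] --> \int[mu]_(y in `]a, b[) (g y * kink_step y).
  apply: (@Rintegral_cvg _ _ _ mu `]a, b[ 
    (fun n y => g y * derive1 (smooth_tent n) y) _ (fun y => `|g y|)) => //.
  - move=> n; apply: measurable_funM => //; apply: measurable_funTS.
    apply: continuous_measurable_fun; apply: smooth_continuous => k.
    by have [] := smooth_tent_smooth n k.+1.
  - exact: integrable_norm (BV_integrable g).
  - move=> y _; apply: cvgMr; under eq_fun do rewrite dE.
    by apply: cvgB; [|rewrite -indic_shift]; exact: plateau_cvg.
  - move=> n y _; rewrite /= normrM ler_piMr// dE ler_norml.
    have := plateau_ge0 (x - r) x n y; have := plateau_ge0 (x - r) x n (y - r).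
    have := plateau_le1 (x - r) x n y; have := plateau_le1 (x - r) x n (y - r).
    by move=> *; apply/andP; split; lra.
have G2 : G n @[n --> \oo] --> - charge_Rintegral (BV_deriv g) `]a, b[ tent.
  under eq_fun do rewrite GE.
  apply: cvgN; apply: (@charge_Rintegral_cvg _ _ _ _ _ _ _ r) => //.
  - move=> n; apply: measurable_funTS; apply: continuous_measurable_fun.
    by apply: smooth_continuous; exact: smooth_tent_smooth.
  - by move=> y _; exact: smooth_tent_cvg.
  - by move=> n y _; apply: normr_tent_of_le => // z; exact: plateau_ge0.
by rewrite -(cvg_lim _ G1)// -(cvg_lim _ G2).
Qed.

End BV_tent.

Lemma measurable_tent (D : set R) : measurable D -> measurable_fun D tent.
Proof.
move=> mD; apply: (@measurable_fun_cvg _ _ _ _ smooth_tent) => [n|y _].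
  apply: measurable_funTS; apply: continuous_measurable_fun.
  by apply: smooth_continuous; exact: smooth_tent_smooth.
exact: smooth_tent_cvg.
Qed.

Lemma normr_tent_le y : `|tent y| <= r.
Proof. by apply: normr_tent_of_le => // z; rewrite indicE. Qed.

Lemma tent_eq0 y : ~ `]x - r, x + r[%classic y -> tent y = 0.
Proof. by apply: tent_of_eq0 => z; rewrite indicE. Qed.

End tent.

(** * Reading off the jump of a function from its integrals against the kink *)

Section jump.
Context {R : realType}.
Local Notation mu := (@lebesgue_measure R).
Implicit Types (a b c x y r t : R) (f g : R -> R).

Lemma charge_RintegralZl d (T : measurableType d) (nu : {charge set T -> \bar R})
    (D : set T) (f : T -> R) c M :
  measurable D -> measurable_fun D f -> (forall z, D z -> `|f z| <= M) ->
  charge_Rintegral nu D (fun z => c * f z) = c * charge_Rintegral nu D f.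
Proof.
move=> mD mf fM; rewrite /charge_Rintegral.
rewrite !RintegralZl//; [|exact: bounded_integrable fM..].
by rewrite mulrBr.
Qed.

(** The tents divided by their heights are bounded by 1, equal 1 at x, and converge pointwise to the
    indicator of {x}; dominated convergence against the derivative of [g] leaves only its atom. *)
Lemma BV_jump_cvg a b (g : BV a b) x (r_ : R^nat) :
  (forall n, 0 < r_ n) -> r_ n @[n --> \oo] --> (0 : R) ->
  (forall n, a < x - r_ n) -> (forall n, x + r_ n < b) ->
  (r_ n)^-1 * \int[mu]_(y in `]a, b[) (g y * kink_step x (r_ n) y) @[n --> \oo]
    --> - fine (BV_deriv g [set x]).
Proof.
move=> r0 r_0 ax xb.
have Ix : `]a, b[%classic x.
  rewrite /= in_itv/=; have := ax 0%N; have := xb 0%N; have := r0 0%N.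
  by move=> *; apply/andP; split; lra.
have -> : (fun n => (r_ n)^-1 * \int[mu]_(y in `]a, b[) (g y * kink_step x (r_ n) y)) =
    (fun n => - charge_Rintegral (BV_deriv g) `]a, b[
                  (fun y => (r_ n)^-1 * tent x (r_ n) y)).
  apply/funext => n; rewrite BV_deriv_tent// (@charge_RintegralZl _ _ _ _ _ _ (r_ n))//.
  - by rewrite mulrN.
  - exact: measurable_tent.
  - by move=> y _; exact: normr_tent_le.
have jumpE : charge_Rintegral (BV_deriv g) `]a, b[ \1_[set x] = fine (BV_deriv g [set x]).
  by apply: charge_Rintegral_set1 => //; exact: measurable_set1.
rewrite -[X in _ --> - X]jumpE.
apply: cvgN; apply: (@charge_Rintegral_cvg _ _ _ _ _ _ _ 1) => //.
- by move=> n; apply: measurable_funM => //; exact: measurable_tent.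
- move=> y _; rewrite indicE; have [->|yx] := eqVneq y x.
    rewrite mem_set//; under eq_fun do rewrite tent_center// mulVf ?gt_eqF//.
    exact: cvg_cst.
  rewrite memNset; last by move/eqP: yx.
  have yx0 : 0 < `|y - x| by rewrite normr_gt0 subr_eq0.
  apply: cvg_near_cst.
  (* For y different from x the sequence is eventually 0: as soon as [r_ n] is at most |y - x|, the
     point y is outside the support. *)
  near=> n; rewrite tent_eq0 ?mulr0//= in_itv/= -ltr_distl.
  apply/negP; rewrite -leNgt.
  near: n; have /cvgr0_norm_le /(_ _ yx0) := r_0.
  by apply: filterS => n; apply: le_trans; exact: ler_norm.
- move=> n y _; rewrite normrM gtr0_norm ?invr_gt0// ler_pdivrMl// mulr1.
  exact: normr_tent_le.
Unshelve. all: by end_near. Qed.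

Lemma continuous_itv_bounded a b f : continuous f ->
  exists M, forall y, `[a, b]%classic y -> `|f y| <= M.
Proof.
move=> cf; have [ba|ab] := ltP b a.
  by exists 0 => y; rewrite /= in_itv/= => /andP[/le_trans/[apply]]; rewrite leNgt ba.
have cnf : {within `[a, b], continuous (fun y => `|f y|)}.
  apply: continuous_subspaceT => y; apply: continuous_comp; first exact: cf.
  exact: norm_continuous.
by have [c _ cM] := EVT_max ab cnf; exists `|f c| => y; exact: cM.
Qed.

Lemma Rintegral_indic_derive1 a b p q f f' : p < q -> a <= p -> q <= b ->
  (forall y : R, is_derive y 1 f (f' y)) -> continuous f' ->
  \int[mu]_(y in `]a, b[) (\1_`]p, q[ y * f' y) = f q - f p.
Proof.
move=> pq ap qb dff' cf'.
have cf : continuous f.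
  move=> y; apply/differentiable_continuous/derivable1_diffP.
  exact: (@ex_derive _ _ _ _ _ _ _ (dff' y)).
transitivity (\int[mu]_(y in `]p, q[) f' y).
  have {2}-> : `]p, q[%classic = `]a, b[ `&` `]p, q[.
    rewrite setIidr// => y /=; rewrite !in_itv/= => /andP[py yq].
    by rewrite (le_lt_trans ap py) (lt_le_trans yq qb).
  rewrite Rintegral_mkcondr; apply: eq_Rintegral => y _.
  by rewrite /patch indicE; case: (y \in _); rewrite ?mul1r ?mul0r.
have mf' : measurable_fun `]p, q[ (EFin \o f').
  apply/measurable_EFinP; apply: measurable_funTS.
  exact: continuous_measurable_fun.
rewrite /Rintegral -(integral_itv_bndoo true false)//.
rewrite (@continuous_FTC2 _ f' f)//.
- exact: continuous_subspaceT.
- split.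
  + by move=> y _; exact: (@ex_derive _ _ _ _ _ _ _ (dff' y)).
  + by apply: cvg_at_right_filter; exact: cf.
  + by apply: cvg_at_left_filter; exact: cf.
- by move=> y _; rewrite derive1E (@derive_val _ _ _ _ _ _ _ (dff' y)).
Qed.

End jump.

(** * Perturbing the minimizer *)

Section competitor.
Context {R : realType}.
Local Notation mu := (@lebesgue_measure R).
Variables (a b x r : R).
Hypotheses (r0 : 0 < r) (ax : a < x - r) (xb : x + r < b).

Lemma mem_itv_kink :
  [/\ `]a, b[%classic (x - r), `]a, b[%classic x & `]a, b[%classic (x + r)].
Proof.
by move: r0 ax xb => *; split; rewrite /= in_itv/=; apply/andP; split; lra.
Qed.

Lemma measurable_kink_step (D : set R) : measurable_fun D (kink_step x r).
Proof.
apply: measurable_funTS; apply: measurable_funB; exact: measurable_indic.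
Qed.

Lemma normr_kink_step_le1 y : `|kink_step x r y| <= 1.
Proof.
rewrite /kink_step !indicE.
by case: (_ \in _); case: (_ \in _);
  rewrite /= ?subrr ?subr0 ?sub0r ?normrN ?normr0 ?normr1.
Qed.

Lemma integrable_kink_step : mu.-integrable `]a, b[ (EFin \o kink_step x r).
Proof.
have ii (p q : R) : mu.-integrable `]a, b[ (EFin \o \1_`]p, q[).
  by apply: integrableS (integrable_indic_itv p q false true).
by apply: (integrableB _ (ii (x - r) x) (ii x (x + r))).
Qed.

(** The fundamental theorem on each half gives f(x) - f(x - r) and f(x + r) - f(x); their difference
    is the pairing with the Dirac masses that [add_kink] adds. *)
Lemma Rintegral_kink_step_derive1 f f' :
  (forall y : R, is_derive y 1 f (f' y)) -> continuous f' ->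
  \int[mu]_(y in `]a, b[) (kink_step x r y * f' y) =
  - (f (x - r) + f (x + r) - 2 * f x).
Proof.
move=> dff' cf'.
have mI : measurable (`]a, b[ : set (measurableTypeR R)) by exact: measurable_itv.
have [M f'M] := continuous_itv_bounded a b cf'.
have f'MI y : `]a, b[%classic y -> `|f' y| <= M.
  by move=> Iy; apply: f'M; exact: subset_itv_oo_cc Iy.
have mf' : measurable_fun `]a, b[ f'.
  by apply: measurable_funTS; exact: continuous_measurable_fun.
have ii (p q : R) : mu.-integrable `]a, b[ (fun y => (\1_`]p, q[ y * f' y)%:E).
  have ipq : mu.-integrable `]a, b[ (EFin \o \1_`]p, q[).
    by apply: integrableS (integrable_indic_itv p q false true).
  exact: (integrableM_bounded mI ipq mf' f'MI).
under eq_Rintegral do rewrite mulrBl.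
rewrite RintegralB//; [|exact: ii..].
rewrite !(@Rintegral_indic_derive1 _ a b _ _ f f')//; last first.
all: move: r0 ax xb => *; lra.
Qed.

Variables (u : BV a b) (t : R).

Definition kinked_fun y := u y + t * kink_step x r y.

Definition kinked_deriv : {charge set (measurableTypeR R) -> \bar R} :=
  add_kink (BV_deriv u) t (x - r) x (x + r).

Lemma kinked_integrable : mu.-integrable `]a, b[ (EFin \o kinked_fun).
Proof.
have mI : measurable (`]a, b[ : set (measurableTypeR R)) by exact: measurable_itv.
exact: (integrableD mI (BV_integrable u)
  (integrableZl mI t integrable_kink_step)).
Qed.

Lemma kinked_concentrated (A : set (measurableTypeR R)) : measurable A ->
  kinked_deriv A = kinked_deriv (A `&` `]a, b[).
Proof.
have [Ip Ix Iq] := mem_itv_kink.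
move=> mA; rewrite !add_kinkE (BV_deriv_concentrated u mA) !in_setI.
by rewrite !(mem_set Ip) !(mem_set Ix) !(mem_set Iq) !andbT.
Qed.

Lemma kinked_derivP (phi : R -> R) : test_function `]a, b[ phi ->
  \int[mu]_(y in `]a, b[) (kinked_fun y * derive1 phi y) =
  - charge_Rintegral kinked_deriv `]a, b[ phi.
Proof.
move=> tphi; have [sphi _] := tphi.
have dphi (y : R) : is_derive y 1 phi (derive1 phi y).
  by apply: is_derive_derive1; exact: (sphi 0%N).
have cphi : continuous phi.
  by move=> y; apply/differentiable_continuous/derivable1_diffP; exact: (sphi 0%N).
have cphi' : continuous (derive1 phi).
  by move=> y; apply/differentiable_continuous/derivable1_diffP; exact: (sphi 1%N).
have [Ip Ix Iq] := mem_itv_kink.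
have mI : measurable (`]a, b[ : set (measurableTypeR R)) by exact: measurable_itv.
have [M phiM] := continuous_itv_bounded a b cphi.
have [M' phi'M] := continuous_itv_bounded a b cphi'.
rewrite (@charge_Rintegral_add_kink _ _ _ _ _ _ _ _ _ _ M)//; last 2 first.
- by apply: measurable_funTS; exact: continuous_measurable_fun.
- by move=> y Iy; apply: phiM; exact: subset_itv_oo_cc Iy.
have mphi' : measurable_fun `]a, b[ (derive1 phi).
  by apply: measurable_funTS; exact: continuous_measurable_fun.
have phi'MI y : `]a, b[%classic y -> `|derive1 phi y| <= M'.
  by move=> Iy; apply: phi'M; exact: subset_itv_oo_cc Iy.
under eq_Rintegral do rewrite mulrDl -mulrA.
rewrite RintegralD//; last 2 first.
- exact: integrableM_bounded mI (BV_integrable u) mphi' phi'MI.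
- exact: (integrableZl _ t
    (integrableM_bounded mI integrable_kink_step mphi' phi'MI)).
rewrite BV_derivP// RintegralZl//; last first.
  exact: integrableM_bounded mI integrable_kink_step mphi' phi'MI.
by rewrite (Rintegral_kink_step_derive1 dphi cphi'); lra.
Qed.

Definition kinked_BV : BV a b :=
  mkBV kinked_integrable kinked_concentrated kinked_derivP.

End competitor.

Section energy.
Context {R : realType}.
Local Notation mu := (@lebesgue_measure R).
Variables (a b : R) (alpha : R -> R) (M : R).
Hypothesis malpha : measurable_fun `]a, b[ alpha.
Hypothesis alpha_ge0 : forall y, `]a, b[%classic y -> 0 <= alpha y.
Hypothesis alpha_le : forall y, `]a, b[%classic y -> alpha y <= M.

(** A bounded weight against a finite variation. Finiteness is what allows energies to be compared
    and subtracted as real numbers. *)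
Lemma weighted_TV_fin (nu : {charge set (measurableTypeR R) -> \bar R}) :
  (\int[charge_total_variation nu]_(y in `]a, b[) (alpha y)%:E)%E \is a fin_num.
Proof.
have mI : measurable (`]a, b[ : set (measurableTypeR R)) by exact: measurable_itv.
have le_cst : (\int[charge_total_variation nu]_(y in `]a, b[) (alpha y)%:E <=
    M%:E * charge_total_variation nu `]a, b[%classic)%E.
  rewrite -integral_cst//; apply: ge0_le_integral => //.
  exact/measurable_EFinP.
have int_ge0 : (0 <= \int[charge_total_variation nu]_(y in `]a, b[) (alpha y)%:E)%E.
  by apply: integral_ge0 => y /alpha_ge0; rewrite lee_fin.
rewrite ge0_fin_numE//; apply: le_lt_trans le_cst _.
have : (M%:E * charge_total_variation nu `]a, b[%classic)%E \is a fin_num.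
  by rewrite fin_numM// charge_total_variation_fin.
by rewrite fin_numElt => /andP[].
Qed.

Lemma BV_measurable (g : BV a b) : measurable_fun `]a, b[ g.
Proof. by apply/measurable_EFinP; exact: measurable_int (BV_integrable g). Qed.

Variables (f u : BV a b).
Hypothesis hu : is_minimizer f alpha u.

(* The competitor [f] has finite energy. *)
Lemma minimizer_sqr_integrable :
  mu.-integrable `]a, b[ (fun y => ((f y - u y) ^+ 2)%:E).
Proof.
apply/integrableP; split.
  apply/measurable_EFinP; apply: measurable_funX.
  by apply: measurable_funB; exact: BV_measurable.
under eq_integral do rewrite gee0_abs ?lee_fin ?sqr_ge0//.
have := hu f; rewrite /weighted_TV_energy.
under [X in (_ <= _ * X + _)%E]eq_integral do rewrite subrr expr0n.
rewrite integral0 mule0 add0e.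
rewrite -(fineK (weighted_TV_fin (BV_deriv f))) -(fineK (weighted_TV_fin (BV_deriv u))).
have : (0 <= \int[mu]_(y in `]a, b[) ((f y - u y) ^+ 2)%:E)%E.
  by apply: integral_ge0 => y _; rewrite lee_fin sqr_ge0.
case: (\int[mu]_(y in _) _)%E => [s| |]//=; rewrite ?ltry//.
by rewrite gt0_muley ?lte_fin.
Qed.

(** Compare [u] with [v] = [u] + t k. Expanding the halved square gives the cross term and at most
    t^2 r, since k^2 integrates to at most 2r; [integral_add_kink_le] bounds the growth of the
    weighted variation. *)
Lemma minimizer_kink_ge0 (x r t : R) : 0 < r -> a < x - r -> x + r < b ->
  0 < t * fine (BV_deriv u [set x]) ->
  `|2 * t| < `|fine (BV_deriv u [set x])| ->
  0 <= `|t| * (alpha (x - r) + alpha (x + r) - 2 * alpha x) -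
       t * \int[mu]_(y in `]a, b[) ((f y - u y) * kink_step x r y) + t ^+ 2 * r.
Proof.
move=> r0 ax xb tm0 tm.
have mI : measurable (`]a, b[ : set (measurableTypeR R)) by exact: measurable_itv.
pose v := kinked_BV r0 ax xb u t.
pose k := kink_step x r.
have mk : measurable_fun `]a, b[ k by exact: measurable_kink_step.
have iw : mu.-integrable `]a, b[ (fun y => (f y - u y)%:E).
  exact: integrableB (BV_integrable f) (BV_integrable u).
have iwk : mu.-integrable `]a, b[ (fun y => ((f y - u y) * k y)%:E).
  exact: (integrableM_bounded mI iw mk
    (fun y _ => normr_kink_step_le1 x r y)).
have ik2 : mu.-integrable `]a, b[ (fun y => (k y * k y)%:E).
  exact: (integrableM_bounded mI (integrable_kink_step a b x r) mk
    (fun y _ => normr_kink_step_le1 x r y)).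
(* As an inequality this survives the impossible case in which y lies in both halves, so the case
   analysis can ignore their disjointness. *)
have k2 : \int[mu]_(y in `]a, b[) (k y * k y) <= 2 * r.
  have int_indic p q : p < q -> a <= p -> q <= b ->
      \int[mu]_(y in `]a, b[) \1_`]p, q[ y = q - p.
    move=> pq ap qb; under eq_Rintegral do rewrite -[\1_ _ _]mulr1.
    by apply: (@Rintegral_indic_derive1 _ a b p q id (cst 1)) => // y; exact: cst_continuous.
  have ii (p q : R) : mu.-integrable `]a, b[ (EFin \o \1_`]p, q[).
    by apply: integrableS (integrable_indic_itv p q false true).
  have -> : 2 * r = \int[mu]_(y in `]a, b[) (\1_`]x - r, x[ y + \1_`]x, x + r[ y).
    by rewrite RintegralD//; [rewrite !int_indic; lra|exact: ii..].
  apply: le_Rintegral => //; first exact: (integrableD mI (ii _ _) (ii _ _)).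
  move=> y _; rewrite /k /kink_step !indicE.
  by case: (_ \in _); case: (_ \in _) => /=; lra.
set W := \int[mu]_(y in `]a, b[) _.
have sqrE : (\int[mu]_(y in `]a, b[) ((f y - v y) ^+ 2)%:E)%E =
    (\int[mu]_(y in `]a, b[) ((f y - u y) ^+ 2) - 2 * t * W +
     t ^+ 2 * \int[mu]_(y in `]a, b[) (k y * k y))%:E.
  have isq := minimizer_sqr_integrable.
  have i1 := integrableD mI isq (integrableZl mI (- (2 * t)) iwk).
  have i2 := integrableD mI i1 (integrableZl mI (t ^+ 2) ik2).
  transitivity (\int[mu]_(y in `]a, b[) ((f y - u y) ^+ 2 +
      - (2 * t) * ((f y - u y) * k y) + t ^+ 2 * (k y * k y))%:E)%E.
    apply: eq_integral => y _; congr EFin.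
    rewrite -[v y]/(u y + t * k y); ring.
  rewrite -(fineK (integrable_fin_num mI i2)); congr EFin.
  rewrite -[LHS]/(\int[mu]_(y in `]a, b[) ((f y - u y) ^+ 2 +
      - (2 * t) * ((f y - u y) * k y) + t ^+ 2 * (k y * k y))).
  rewrite RintegralD//; last exact: (integrableZl mI (t ^+ 2) ik2).
  rewrite RintegralD//; last exact: (integrableZl mI (- (2 * t)) iwk).
  by rewrite !RintegralZl// mulNr.
have fin_u := weighted_TV_fin (BV_deriv u).
have fin_v := weighted_TV_fin (BV_deriv v).
pose Bu := fine (\int[charge_total_variation (BV_deriv u)]_(y in `]a, b[) (alpha y)%:E).
pose Bv := fine (\int[charge_total_variation (BV_deriv v)]_(y in `]a, b[) (alpha y)%:E).
have TVle : Bv + `|t| * (2 * alpha x) <= Bu + `|t| * (alpha (x - r) + alpha (x + r)).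
  have [Ip Ix Iq] := mem_itv_kink r0 ax xb.
  have px : x - r != x by rewrite lt_eqF// gtrBl.
  have qx : x + r != x by rewrite gt_eqF// ltrDl.
  rewrite -lee_fin [leLHS]EFinD [leRHS]EFinD !fineK//.
  exact: (integral_add_kink_le mI malpha alpha_ge0 Ip Ix Iq (measurable_set1 x) px qx tm0 tm).
have Ele : 2^-1 * \int[mu]_(y in `]a, b[) ((f y - u y) ^+ 2) + Bu <=
    2^-1 * (\int[mu]_(y in `]a, b[) ((f y - u y) ^+ 2) - 2 * t * W +
     t ^+ 2 * \int[mu]_(y in `]a, b[) (k y * k y)) + Bv.
  rewrite -lee_fin [leLHS]EFinD [leRHS]EFinD !fineK// EFinM [in leRHS]EFinM -sqrE.
  rewrite fineK; last exact: integrable_fin_num minimizer_sqr_integrable.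
  exact: hu v.
have t2 : t ^+ 2 * \int[mu]_(y in `]a, b[) (k y * k y) <= t ^+ 2 * (2 * r).
  by rewrite ler_wpM2l// sqr_ge0.
move: TVle Ele t2; clear.
by move: Bu Bv W (Rintegral _ _ _) (Rintegral _ _ _) `|t| => *; lra.
Qed.

End energy.

(** With the Carathéodory slope g, where f(y) - f(x) = g(y)(y - x), the quotient is exactly g(x + r)
    - g(x - r). Continuity of g at x sends it to 0; differentiability at this single point is
    enough. *)
Lemma second_difference_cvg (R : realType) (f : R -> R) (x : R) (r_ : R^nat) :
  derivable f x 1 -> (forall n, 0 < r_ n) -> r_ n @[n --> \oo] --> (0 : R) ->
  (r_ n)^-1 * (f (x - r_ n) + f (x + r_ n) - 2 * f x) @[n --> \oo] --> (0 : R).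
Proof.
move=> df r0 r_0.
have /is_derive1_caratheodory[g [fE gc _]] := is_derive_derive1 df.
have -> : (fun n => (r_ n)^-1 * (f (x - r_ n) + f (x + r_ n) - 2 * f x)) =
    (fun n => g (x + r_ n) - g (x - r_ n)).
  apply/funext => n; have rn : r_ n != 0 by rewrite gt_eqF.
  have -> : f (x - r_ n) + f (x + r_ n) - 2 * f x =
      (f (x - r_ n) - f x) + (f (x + r_ n) - f x) by ring.
  by rewrite !fE; field.
rewrite -(subrr (g x)); apply: cvgB; apply: continuous_cvg => //.
- by rewrite -[X in _ --> X]addr0; apply: cvgD => //; exact: cvg_cst.
- by rewrite -[X in _ --> X]subr0; apply: cvgB => //; exact: cvg_cst.
Qed.

Theorem proposition3p3 (R : realType) (a b : R) (hab : a < b)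
  (f : BV a b) (alpha : R -> R)
  (alpha_cont : {within `[a, b], continuous alpha})
  (alpha_gt0 : forall y : R, y \in `[a, b] -> 0 < alpha y)
  (u : BV a b) (hu : is_minimizer f alpha u)
  (x : R) (hx : x \in `]a, b[)
  (alpha_diff : derivable alpha x 1)
  (hxf : ~ jump_set f x) :
  ~ jump_set u x.
Proof.
move=> [_ uJ]; set m := fine (BV_deriv u [set x]).
have mx : measurable ([set x] : set (measurableTypeR R)) by exact: measurable_set1.
have m0 : m != 0.
  apply/eqP => m0; apply: uJ; apply: charge_total_variation_set1 => //.
  by rewrite -(fineK (fin_num_measure (BV_deriv u) _ mx)) -/m m0.
have fx0 : fine (BV_deriv f [set x]) = 0.
  have tv0 : charge_total_variation (BV_deriv f) [set x] = 0%E.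
    by apply: contra_notP hxf => tv0; split.
  have := le_normr_charge_total_variation (BV_deriv f) mx.
  by rewrite tv0/= normr_le0 => /eqP.
have mI : measurable (`]a, b[ : set (measurableTypeR R)) by exact: measurable_itv.
have malpha : measurable_fun `]a, b[ alpha.
  apply: (measurable_funS (measurable_itv `[a, b])); first exact: subset_itv_oo_cc.
  apply: subspace_continuous_measurable_fun => //; exact: measurable_itv.
have alpha_ge0 y : `]a, b[%classic y -> 0 <= alpha y.
  by move=> Iy; apply/ltW/alpha_gt0; exact: subset_itv_oo_cc Iy.
have [z _ alpha_max] := EVT_max (ltW hab) alpha_cont.
have alpha_le y : `]a, b[%classic y -> alpha y <= alpha z.
  by move=> Iy; apply: alpha_max; exact: subset_itv_oo_cc Iy.
move: hx; rewrite in_itv/= => /andP[ax xb].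
(* Halving the distance to the boundary makes both inequalities strict, so every kink, including the
   one for n = 0, lies inside ]a, b[. *)
have [rho [rho0 rhoa rhob]] : exists rho : R, [/\ 0 < rho, rho < x - a & rho < b - x].
  exists (Num.min (x - a) (b - x) / 2).
  have : 0 < Num.min (x - a) (b - x) by rewrite lt_min !subr_gt0 ax xb.
  have : Num.min (x - a) (b - x) <= x - a by rewrite ge_min lexx.
  have : Num.min (x - a) (b - x) <= b - x by rewrite ge_min lexx orbT.
  by move: (Num.min _ _) => w *; split; lra.
pose r_ n := rho * n.+1%:R^-1.
have r0 n : 0 < r_ n by rewrite mulr_gt0// invr_gt0.
have r_le n : r_ n <= rho by rewrite /r_ ler_piMr ?(ltW rho0)// invf_le1 ?ler1n ?ltr0n.
have r_0 : r_ n @[n --> \oo] --> (0 : R).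
  rewrite -[X in _ --> X](mulr0 rho); apply: cvgMr; exact: cvg_harmonic.
have axr n : a < x - r_ n by have := r_le n; lra.
have xbr n : x + r_ n < b by have := r_le n; lra.
(* The factor 1/4 meets two demands: below 1/2, so that the atom keeps its sign after losing 2t, and
   below 1, so that t^2 < t m. *)
pose t := m / 4.
have tm0 : 0 < t * m by rewrite /t mulrAC divr_gt0// -expr2 exprn_even_gt0.
have tm : `|2 * t| < `|m|.
  have -> : 2 * t = m / 2 by rewrite /t; field.
  by rewrite normrM gtr_pMr ?normr_gt0// gtr0_norm ?invf_lt1 ?ltr1n ?invr_gt0.
(* The integral of (f - u) k is split, because [BV_jump_cvg] applies to [f] and [u] separately. *)
have ineq n : 0 <= `|t| * ((r_ n)^-1 *
      (alpha (x - r_ n) + alpha (x + r_ n) - 2 * alpha x)) -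
    t * ((r_ n)^-1 * \int[lebesgue_measure]_(y in `]a, b[) (f y * kink_step x (r_ n) y) -
         (r_ n)^-1 * \int[lebesgue_measure]_(y in `]a, b[) (u y * kink_step x (r_ n) y)) +
    t ^+ 2.
  have := minimizer_kink_ge0 malpha alpha_ge0 alpha_le hu (r0 n) (axr n) (xbr n) tm0 tm.
  have mk : measurable_fun `]a, b[ (kink_step x (r_ n)) by exact: measurable_kink_step.
  have kM (y : R) : `]a, b[%classic y -> `|kink_step x (r_ n) y| <= 1.
    by move=> _; exact: normr_kink_step_le1.
  have iM (g : BV a b) := integrableM_bounded mI (BV_integrable g) mk kM.
  under eq_Rintegral do rewrite mulrBl.
  rewrite RintegralB//; [|exact: iM..].
  have rn0 : r_ n != 0 by rewrite gt_eqF.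
  move=> ge0; have : 0 <= (r_ n)^-1 by rewrite invr_ge0 ltW.
  by move=> /mulr_ge0 /(_ ge0); congr (0 <= _); field.
have lim : `|t| * ((r_ n)^-1 *
      (alpha (x - r_ n) + alpha (x + r_ n) - 2 * alpha x)) -
    t * ((r_ n)^-1 * \int[lebesgue_measure]_(y in `]a, b[) (f y * kink_step x (r_ n) y) -
         (r_ n)^-1 * \int[lebesgue_measure]_(y in `]a, b[) (u y * kink_step x (r_ n) y)) +
    t ^+ 2 @[n --> \oo] --> `|t| * 0 - t * (- 0 - - m) + t ^+ 2.
  apply: cvgD; last exact: cvg_cst.
  apply: cvgB; apply: cvgMr; first exact: second_difference_cvg.
  by apply: cvgB; [rewrite -fx0|]; exact: BV_jump_cvg.
have : 0 <= `|t| * 0 - t * (- 0 - - m) + t ^+ 2.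
  apply: (closed_cvg (fun y : R => 0 <= y)) lim; first exact: closed_ge.
  exact: nearW.
(* The limit equals -m^2/4 + m^2/16 = -3m^2/16, which cannot be nonnegative. *)
have : 0 < m ^+ 2 by rewrite exprn_even_gt0.
by rewrite /t mulr0 !expr2; lra.
Qed.
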